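(* Let $\partial\Omega\in C^4$ and let $\mathcal A$ be sufficiently smooth that $E\in W^{2,\infty}(\Omega_{\delta_1})$ for some $\delta_1\in(0,\delta_\Omega)$, where $E(x)=\operatorname{trace}\big(\mathcal A(x)\,Dd(x)\otimes Dd(x)\big)$. Suppose that there are constants $0<\lambda\le\Lambda$ with $$0\le \operatorname{trace}\big(\mathcal A(x)\,\xi\otimes\xi\big)\le\Lambda\quad (x\in\Omega,\ \xi\in\mathbb R^N,\ |\xi|=1),\qquad \lambda\le\operatorname{trace}\big(\mathcal A(x)\,\mathbf n(x)\otimes \mathbf n(x)\big)\quad (x\in\Omega_{\delta_\Omega}).$$ Let $$m>1,\qquad q>\frac{2m}{m-1},\qquad \gamma=\frac{q(m-1)-2m}{m}>0 .$$ (i) If $\limsup_{d(x)\searrow0}f(x)\,d(x)^q\le\ell_u$ with $\ell_u>0$, then any solution $u$ of $-\operatorname{trace}\mathcal A(\cdot)D^2u+u^m\le f$ in $\Omega$ satisfies $$\limsup_{d(x)\searrow0}\frac{u^*(x)}{d(x)^{-\frac qm}\big(1+C_{1,u}(x)\,d(x)^\gamma\big)}\le\ell_u^{\frac1m},\qquad C_{1,u}(x)=\frac{(q+m)q}{m^3}\,\ell_u^{\frac{m}{m-1}}\,E(x).$$ (ii) If $\liminf_{d(x)\searrow0}f(x)\,d(x)^q\ge\ell_d>0$, then any nonnegative large solution $v$ of $-\operatorname{trace}\mathcal A(\cdot)D^2v+v^m\ge f$ in $\Omega$ satisfies $$\liminf_{d(x)\searrow0}\frac{v_*(x)}{d(x)^{-\frac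 qm}\big(1+C_{1,d}(x)\,d(x)^\gamma\big)}\ge\ell_d^{\frac1m},\qquad C_{1,d}(x)=\frac{(q+m)q}{m^3}\,\ell_d^{\frac{m}{m-1}}\,E(x).$$
   Context: $\Omega\subset\mathbb R^N$, $N>1$, is a bounded open set, $d(x)=\operatorname{dist}(x,\partial\Omega)$, $\Omega_\delta=\{x\in\Omega: d(x)<\delta\}$. When $\partial\Omega\in C^4$, $\delta_\Omega>0$ is a constant such that $d\in C^4(\Omega_{\delta_\Omega})$ (there $|Dd|=1$), and $\mathbf n(x)=-Dd(x)$ for $x\in\Omega_{\delta_\Omega}$. $\mathcal S^N$ is the set of real symmetric $N\times N$ matrices and $\mathcal S^N_+$ those with nonnegative eigenvalues. $\mathcal A:\Omega\to\mathcal S^N_+\setminus\{0\}$ is Lipschitz continuous; $\operatorname{trace}(\mathcal A\,\xi\otimes\xi)=\langle\mathcal A\xi,\xi\rangle$. $f:\Omega\to\mathbb R$. The nonlinearity $t^m$ is considered on $[0,\infty)$ (so $u^m$ presupposes that $u$ takes values in $[0,\infty)$). Solutions are viscosity solutions. $u^*(x)=\limsup_{y\to x}u(y)$ and $v_*(x)=\liminf_{y\to x}v(y)$ are the upper and lower semicontinuous envelopes. A function $u$ locally bounded from above is a solution of $-\operatorname{trace}\mathcal A D^2u+u^m\le f$ if $-\operatorname{trace}(\mathcal A(x)X)+(u^*(x))^m\le f(x)$ for all $x\in\Omega$ and all $(p,X)\in\mathbb R^N\times\mathcal S^N$ with $u^*(y)\le u^*(x)+\langle p,y-x\rangle+\frac12\langle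 X(y-x),y-x\rangle+o(|y-x|^2)$ as $y\to x$. A function $v$ locally bounded from below is a solution of $-\operatorname{trace}\mathcal A D^2v+v^m\ge f$ if $-\operatorname{trace}(\mathcal A(x)X)+(v_*(x))^m\ge f(x)$ for all $x\in\Omega$ and all $(p,X)$ with $v_*(y)\ge v_*(x)+\langle p,y-x\rangle+\frac12\langle X(y-x),y-x\rangle+o(|y-x|^2)$. ''Large'' means blowing up on the boundary: $v_*(x)\to+\infty$ as $d(x)\to0$. *)

(* Defs.v *)
From HB Require Import structures.
From mathcomp Require Import all_boot all_order all_algebra.
From mathcomp Require Import all_classical all_reals all_analysis.
Import Order.TTheory GRing.Theory Num.Theory.
Import numFieldNormedType.Exports.

Set Implicit Arguments.
Unset Strict Implicit.
Unset Printing Implicit Defensive.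

Local Open Scope classical_set_scope.
Local Open Scope ring_scope.

(* Points of R^N are row vectors. The library norm on 'rV[R]_N is the sup norm;
   it only serves for the topology, boundedness and Lipschitz continuity, which
   do not depend on the norm. Distances use the Euclidean norm. *)

Section Euclidean.
Context {R : realType} {N : nat}.
Implicit Types (x y : 'rV[R]_N) (M : 'M[R]_N).

Definition dotv x y : R := \sum_(i < N) x 0 i * y 0 i.

Definition euclid x : R := Num.sqrt (dotv x x).

Definition otimes x y : 'M[R]_N := x^T *m y.

(* The cone S^N_+ of symmetric matrices with nonnegative eigenvalues. *)
Definition nonneg_symmetric M : Prop :=
  M^T = M /\ forall a : R, eigenvalue M a -> 0 <= a.

Definition boundary (D : set 'rV[R]_N) : set 'rV[R]_N := closure D `\` D°.

Definition dist_bd (D : set 'rV[R]_N) x : R :=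
  inf [set euclid (x - y) | y in boundary D].

Definition collar (D : set 'rV[R]_N) (r : R) : set 'rV[R]_N :=
  D `&` [set x | dist_bd D x < r].

(* The filter "d(x) tends to 0, x in D". *)
Definition to_bd (D : set 'rV[R]_N) : set_system 'rV[R]_N :=
  filter_from [set r : R | 0 < r] (collar D).

End Euclidean.

Section Differentiability.
Context {R : realType}.

(* Class C^k on an open set U. *)
Fixpoint Ck {N : nat} (k : nat) (U : set 'rV[R]_N) (f : 'rV[R]_N -> R) : Prop :=
  match k with
  | 0 => forall x, U x -> {for x, continuous f}
  | j.+1 => (forall x, U x -> differentiable f x) /\
            forall i : 'I_N, Ck j U ('D_(delta_mx 0 i) f)
  end.

Definition grad {N : nat} (f : 'rV[R]_N -> R) (x : 'rV[R]_N) : 'rV[R]_N :=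
  \row_(i < N) 'D_(delta_mx 0 i) f x.

(* The boundary of D is of class C^k: near each of its points, D lies strictly
   on one side of the graph of a C^k function expressing some coordinate x_i in
   terms of the remaining ones, which are the entries of col' i x. *)
Definition Ck_boundary {N : nat} (k : nat) (D : set 'rV[R]_N) : Prop :=
  forall z, boundary D z ->
    exists (i : 'I_N) (s : bool) (g : 'rV[R]_N.-1 -> R), Ck k setT g /\
      \forall x \near z, D x <-> 0 < (-1) ^+ s * (x 0 i - g (col' i x)).

End Differentiability.

(* Lebesgue measure on R^N: the Caratheodory measure of the outer measure
   given by countable covers by boxes. The value None stands for the empty set,
   so that finite covers are included even for N = 0. *)
Section Lebesgue.
Context (R : realType) (N : nat).
Local Open Scope ereal_scope.

Definition box (c : option ('rV[R]_N * 'rV[R]_N)) : set 'rV[R]_N :=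
  if c is Some (a, b) then
    [set x | forall i : 'I_N, (a 0%R i < x 0%R i <= b 0%R i)%R] else set0.

Definition box_volume (c : option ('rV[R]_N * 'rV[R]_N)) : \bar R :=
  if c is Some (a, b) then
    (\prod_(i < N) Num.max 0 (b 0 i - a 0 i))%R%:E else 0.

Definition leb_outer (X : set 'rV[R]_N) : \bar R :=
  ereal_inf [set \sum_(k <oo) box_volume (c k) |
              c in [set c : nat -> option ('rV[R]_N * 'rV[R]_N) |
                     X `<=` \bigcup_k box (c k)]].

Lemma box_volume_ge0 c : 0 <= box_volume c.
Proof.
case: c => [[a b]|] //=; rewrite lee_fin; apply: prodr_ge0 => i _.
by rewrite le_max lexx.
Qed.

Lemma leb_outer_ge0 X : 0 <= leb_outer X.
Proof.
apply: le_ereal_inf_tmp => _ [c _ <-].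
by apply: nneseries_ge0 => k _ _; exact: box_volume_ge0.
Qed.

Lemma leb_outer0 : leb_outer set0 = 0.
Proof.
apply/eqP; rewrite eq_le leb_outer_ge0 andbT.
apply: ereal_inf_lbound; exists (fun=> None) => //=.
exact: eseries0.
Qed.

Lemma le_leb_outer : {homo leb_outer : A B / A `<=` B >-> A <= B}.
Proof.
move=> A B AB; apply/ereal_inf_le_tmp => _ [c Bc <-].
by exists c => //; apply: subset_trans AB Bc.
Qed.

Lemma leb_outer_sigma_subadditive : sigma_subadditive leb_outer.
Proof.
move=> A; have [[i ioo]|] := pselect (exists i, leb_outer (A i) = +oo).
  rewrite (eseries_pinfty _ _ ioo) ?leey// => n _.
  by rewrite -ltNye (lt_le_trans _ (leb_outer_ge0 _)).
rewrite -forallNE => Aoo.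
apply/lee_addgt0Pr => _/posnumP[e].
rewrite (le_trans _ (epsilon_trick _ _ _))//; last first.
  by move=> n; exact: leb_outer_ge0.
pose P n (c : nat -> option ('rV[R]_N * 'rV[R]_N)) :=
  A n `<=` \bigcup_k box (c k) /\
  \sum_(k <oo) box_volume (c k) <= leb_outer (A n) + (e%:num / (2 ^ n.+1)%:R)%:E.
have [G PG] : {G & forall n, P n (G n)}.
  apply: (@choice _ _ P) => n.
  have en1 : (0 < e%:num / (2 ^ n.+1)%:R)%R by [].
  have lebfin : leb_outer (A n) \is a fin_num.
    by rewrite ge0_fin_numE ?leb_outer_ge0// ltey; apply/eqP/Aoo.
  have [_ [c Ac <-] /ltW lec] := lb_ereal_inf_adherent en1 lebfin.
  by exists c.
pose v (x : nat * nat) := box_volume (G x.1 x.2).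
have v_ge0 x : 0 <= v x by exact: box_volume_ge0.
apply: (@le_trans _ _ (\esum_(i in setT) v i)).
  have /card_esym/ppcard_eqP[f] := card_nat2.
  apply: ereal_inf_lbound => /=; exists (fun k => G (f k).1 (f k).2).
    move=> t [i _] /(PG i).1 [j _ Gt].
    by exists (f^-1%FUN (i, j)) => //=; rewrite invK ?inE.
  rewrite -(esum_pred_image v _ xpredT) ?[fun=> _]set_true//.
  by rewrite image_eq.
rewrite (_ : esum _ _ = \sum_(i <oo) \sum_(j <oo) v (i, j)); last first.
  pose J : nat -> set (nat * nat) := fun i => [set (i, j) | j in setT].
  rewrite (_ : setT = \bigcup_k J k); last first.
    by rewrite predeqE => -[a b]; split => // _; exists a => //; exists b.
  rewrite esum_bigcupT /=; last 2 first.
    - apply/trivIsetP => i j _ _ ij.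
      rewrite predeqE => -[n m] /=; split => //= -[] [_] _ [<-{n} _].
      by move=> [m' _] [] /esym/eqP; rewrite (negbTE ij).
    - by move=> x; exact: v_ge0.
  rewrite -(image_id [set: nat]) -fun_true esum_pred_image//; last first.
    by move=> n _; exact: esum_ge0.
  apply: eq_eseriesr => /= j _.
  rewrite -(esum_pred_image v (pair j) predT)//=; last first.
    by move=> ? ? _ _; exact: (@can_inj _ _ _ snd).
  by congr esum; rewrite predeqE => -[a b]; split; move=> [i _ <-]; exists i.
apply: lee_nneseries => n; last by move=> _; exact: (PG n).2.
by move=> _ _; apply: nneseries_ge0 => k _ _; exact: v_ge0.
Qed.

HB.instance Definition _ := isOuterMeasure.Build R 'rV[R]_N leb_outer
  leb_outer0 leb_outer_ge0 le_leb_outer leb_outer_sigma_subadditive.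

(* R^N with the sigma-algebra of Lebesgue measurable sets. *)
Definition lebRn := caratheodory_type leb_outer.

HB.instance Definition _ := Measurable.on lebRn.

Definition lebesgueRn : set lebRn -> \bar R := leb_outer.

HB.instance Definition _ := isMeasure.Build _ lebRn R lebesgueRn
  (@caratheodory_measure0 R 'rV[R]_N leb_outer)
  (@caratheodory_measure_ge0 R 'rV[R]_N leb_outer)
  (@caratheodory_measure_sigma_additive R 'rV[R]_N leb_outer).

End Lebesgue.

Arguments lebesgueRn : clear implicits.

Section Sobolev.
Context {R : realType} {N : nat}.
Implicit Types (U : set 'rV[R]_N) (f g phi : 'rV[R]_N -> R).

Definition test_function U phi : Prop :=
  (forall k, Ck k setT phi) /\
  compact (closure [set x | phi x != 0]) /\
  closure [set x | phi x != 0] `<=` U.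

Definition in_Linfty U f : Prop :=
  measurable_fun (U : set (lebRn R N)) (f : lebRn R N -> R) /\
  exists M : R, {ae lebesgueRn R N, forall x, U x -> `|f x| <= M}.

(* g is the weak derivative of f on U with respect to the i-th variable. *)
Definition weak_partial U (i : 'I_N) f g : Prop :=
  forall phi, test_function U phi ->
    (\int[lebesgueRn R N]_(x in U) (f x * 'D_(delta_mx 0 i) phi x) =
     - \int[lebesgueRn R N]_(x in U) (g x * phi x))%R.

(* The Sobolev space W^{k,infty}(U). *)
Fixpoint in_Wkinfty (k : nat) U f : Prop :=
  in_Linfty U f /\
  match k with
  | 0 => True
  | j.+1 => forall i : 'I_N, exists g, weak_partial U i f g /\ in_Wkinfty j U g
  end.

End Sobolev.

Section Viscosity.
Context {R : realType} {N : nat}.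
Implicit Types (D : set 'rV[R]_N) (u v w f : 'rV[R]_N -> R)
  (A : 'rV[R]_N -> 'M[R]_N).

Definition locally_bounded_above D u : Prop :=
  forall x, D x -> exists M : R, \forall y \near x, u y <= M.

Definition locally_bounded_below D u : Prop :=
  forall x, D x -> exists M : R, \forall y \near x, M <= u y.

(* Semicontinuous envelopes. The neighbourhoods of x contain x itself, so that
   v_* <= v and u <= u^*; the values of fine are genuine at points of an open
   set where u (resp. v) is locally bounded from above (resp. below), and they
   only depend on u near x. *)
Definition usc_env u (x : 'rV[R]_N) : R :=
  fine (limf_esup (fun y => (u y)%:E) (nbhs x)).

Definition lsc_env v (x : 'rV[R]_N) : R :=
  fine (limf_einf (fun y => (v y)%:E) (nbhs x)).

Definition quadratic (p : 'rV[R]_N) (X : 'M[R]_N) (z : 'rV[R]_N) : R :=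
  dotv p z + 2^-1 * dotv (z *m X) z.

(* (p, X) in R^N x S^N is a second order super-(sub-)jet of w at x; the terms
   o(|y-x|^2) are written out with epsilon. *)
Definition superjet w (x p : 'rV[R]_N) (X : 'M[R]_N) : Prop :=
  X^T = X /\
  forall e : R, 0 < e -> \forall y \near x,
    w y <= w x + quadratic p X (y - x) + e * euclid (y - x) ^+ 2.

Definition subjet w (x p : 'rV[R]_N) (X : 'M[R]_N) : Prop :=
  X^T = X /\
  forall e : R, 0 < e -> \forall y \near x,
    w y >= w x + quadratic p X (y - x) - e * euclid (y - x) ^+ 2.

(* Viscosity solutions in D of - trace (A D^2 u) + u^m <= f, resp. >= f. *)
Definition viscosity_sub D A (m : R) f u : Prop :=
  locally_bounded_above D u /\
  forall x p X, D x -> superjet (usc_env u) x p X ->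
    - \tr (A x *m X) + usc_env u x `^ m <= f x.

Definition viscosity_super D A (m : R) f v : Prop :=
  locally_bounded_below D v /\
  forall x p X, D x -> subjet (lsc_env v) x p X ->
    - \tr (A x *m X) + lsc_env v x `^ m >= f x.

Definition large D v : Prop := lsc_env v @ to_bd D --> +oo.

(* E = trace (A Dd (x) Dd). *)
Definition normal_diffusion D A (x : 'rV[R]_N) : R :=
  \tr (A x *m otimes (grad (dist_bd D) x) (grad (dist_bd D) x)).

(* C_1 = (q+m)q/m^3 l^(m/(m-1)) E, with l = l_u or l_d. *)
Definition corrector D A (m q l : R) (x : 'rV[R]_N) : R :=
  (q + m) * q / m ^+ 3 * l `^ (m / (m - 1)) * normal_diffusion D A x.

End Viscosity.

(* Main.v *)
Require Import Defs.
From HB Require Import structures.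
From mathcomp Require Import all_boot all_order all_algebra.
From mathcomp Require Import all_classical all_reals all_analysis.
From mathcomp Require Import ring lra.
Import Order.TTheory GRing.Theory Num.Theory.
Import numFieldNormedType.Exports.
Local Open Scope classical_set_scope.
Local Open Scope ring_scope.

(** The quotient in the theorem has the factor [1 + C_1 d^gamma] with [gamma > 0]
and [C_1] nonnegative and bounded near the boundary ([normal_diffusion_bounds]),
so this factor tends to [1] from above. Both assertions thus reduce to the
leading rate: [u^* d^(q/m)] is asymptotically at most [l_u^(1/m)], and
[v_* d^(q/m)] at least [l_d^(1/m)].

The leading rate is a local matter. Around a point [x] at distance [r] from the
boundary consider the Euclidean ball of radius [t r], [0 < t < 1]. It lies in
the domain, the distance varies on it between [(1 - t) r] and [(1 + t) r], and so
the source [f] is comparable to [l r^(-q)] up to factors that tend to [1] with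
[t]. The diffusion acts on functions of size [r^(-q/m)] at the scale [t r], hence
with strength [r^(-q/m-2) / t^2], which is of smaller order than [r^(-q)] exactly
when [q > 2m/(m-1)]. At leading order the equation therefore says [u^m = f].

Two barriers in the ball make this rigorous. From above, a Keller-Osserman
barrier, infinite on the sphere, bounds a subsolution at the centre by
[(sup f)^(1/m) + C (t r)^(-2/(m-1))] without information on the sphere
([viscosity_sub_ball]). From below, a concave paraboloid vanishing on the sphere
suffices, because the supersolution is nonnegative ([viscosity_super_ball]).
In both cases the barrier is compared with a semicontinuous envelope at an
extremum over the closed ball ([compact_usc_max]), which supplies an explicit
jet with scalar Hessian, and only the trace of [A] enters. Letting first [r] and
then [t] tend to [0] gives the two rates ([sub_rate], [super_rate]). *)

Set Implicit Arguments.
Unset Strict Implicit.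
Unset Printing Implicit Defensive.

(** * Euclidean geometry *)
Section Euclid.
Context {R : realType} {N : nat}.
Implicit Types x y z : 'rV[R]_N.

Lemma dotvC x y : dotv x y = dotv y x.
Proof. by apply: eq_bigr => i _; rewrite mulrC. Qed.

Lemma dotvDl x y z : dotv (x + y) z = dotv x z + dotv y z.
Proof. by rewrite /dotv -big_split; apply: eq_bigr => i _; rewrite mxE mulrDl. Qed.

Lemma dotvZl a x y : dotv (a *: x) y = a * dotv x y.
Proof. by rewrite /dotv mulr_sumr; apply: eq_bigr => i _; rewrite mxE mulrA. Qed.

Lemma dotvDr x y z : dotv x (y + z) = dotv x y + dotv x z.
Proof. by rewrite dotvC dotvDl !(dotvC x). Qed.

Lemma dotvZr a x y : dotv x (a *: y) = a * dotv x y.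
Proof. by rewrite dotvC dotvZl dotvC. Qed.

Lemma dotv_ge0 x : 0 <= dotv x x.
Proof. by apply: sumr_ge0 => i _; rewrite -expr2 sqr_ge0. Qed.

Lemma euclid_ge0 x : 0 <= euclid x.
Proof. exact: sqrtr_ge0. Qed.

Lemma sqr_euclid x : euclid x ^+ 2 = dotv x x.
Proof. by rewrite sqr_sqrtr ?dotv_ge0. Qed.

Lemma abs_coord_le_euclid x i : `|x 0 i| <= euclid x.
Proof.
rewrite -sqrtr_sqr ler_wsqrtr// /dotv (bigD1 i)//= -expr2 lerDl.
by apply: sumr_ge0 => j _; rewrite -expr2 sqr_ge0.
Qed.

Lemma norm_le_euclid x : `|x| <= euclid x.
Proof.
have [->|] := eqVneq `|x| 0; first exact: euclid_ge0.
by move=> /mx_norm_neq0[[i j] /= xij]; rewrite [`|x|]xij (ord1 i) abs_coord_le_euclid.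
Qed.

(** Expand the nonnegative square of the length of [a x - b y] with
[a = dotv y y] and [b = dotv x y]. *)
Lemma dotv_CauchySchwarz x y : dotv x y ^+ 2 <= dotv x x * dotv y y.
Proof.
have [y0|ynz] := eqVneq (dotv y y) 0.
  suff -> : dotv x y = 0 by rewrite y0 expr0n mulr0.
  apply: big1 => i _; suff -> : y 0 i = 0 by rewrite mulr0.
  apply/eqP; rewrite -normr_le0 (le_trans (abs_coord_le_euclid _ _))//.
  by rewrite /euclid y0 sqrtr0.
have y_gt0 : 0 < dotv y y by rewrite lt_def ynz dotv_ge0.
have := dotv_ge0 (dotv y y *: x + (- dotv x y) *: y).
rewrite !(dotvDl, dotvDr, dotvZl, dotvZr) (dotvC y x) => H.
rewrite -subr_ge0 -(pmulr_rge0 _ y_gt0); apply: le_trans H _.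
by rewrite le_eqVlt; apply/orP; left; apply/eqP; ring.
Qed.

Lemma abs_dotv_le x y : `|dotv x y| <= euclid x * euclid y.
Proof.
rewrite -(@ler_pXn2r _ 2) ?nnegrE ?mulr_ge0 ?euclid_ge0//.
by rewrite exprMn !sqr_euclid real_normK ?num_real ?dotv_CauchySchwarz.
Qed.

Lemma euclidD x y : euclid (x + y) <= euclid x + euclid y.
Proof.
rewrite -(@ler_pXn2r _ 2) ?nnegrE ?addr_ge0 ?euclid_ge0//.
rewrite sqrrD !sqr_euclid !(dotvDl, dotvDr) (dotvC y x).
have := le_trans (ler_norm _) (abs_dotv_le x y).
by move: (dotv _ _) (euclid _ * _) => *; lra.
Qed.

Lemma euclidZ a x : euclid (a *: x) = `|a| * euclid x.
Proof. by rewrite /euclid dotvZl dotvZr mulrA -expr2 sqrtrM ?sqr_ge0// sqrtr_sqr. Qed.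

Lemma euclid0 : euclid (0 : 'rV[R]_N) = 0.
Proof. by rewrite -(scale0r 0) euclidZ normr0 mul0r. Qed.

Lemma euclidBC x y : euclid (x - y) = euclid (y - x).
Proof. by rewrite -opprB -scaleN1r euclidZ normrN1 mul1r. Qed.

Lemma euclid_delta (i : 'I_N) : euclid (delta_mx 0 i : 'rV[R]_N) = 1.
Proof.
rewrite /euclid /dotv (bigD1 i)//= big1 => [|j ji].
  by rewrite !mxE !eqxx mulr1 addr0 sqrtr1.
by rewrite !mxE (negbTE ji) andbF mulr0.
Qed.

Lemma dotv_continuous (f g : 'rV[R]_N -> 'rV[R]_N) x :
  {for x, continuous f} -> {for x, continuous g} ->
  {for x, continuous (fun y => dotv (f y) (g y))}.
Proof.
move=> cf cg; have coord (h : 'rV[R]_N -> 'rV[R]_N) i : {for x, continuous h} -> {for x, continuous (fun y => h y 0 i : R)}.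
  move=> ch; apply: (@continuous_comp _ _ _ h (fun z : 'rV[R]_N => z 0 i : R)) => //.
  exact: coord_continuous.
rewrite /prop_for /continuous_at /dotv.
have addc : continuous (fun z : R * R => z.1 + z.2) by exact: add_continuous.
apply: (@cvg_big R 'I_N +%R 0 xpredT addc _ (nbhs x)) => i _.
by apply: cvgM; exact: coord.
Qed.

Lemma subr_continuous_rV (x0 : 'rV[R]_N) : continuous (fun x => x - x0).
Proof. move=> x; apply: (@cvgB _ _ _ (nbhs x) (nbhs_filter x)).
  exact: cvg_id.
exact: cvg_cst. Qed.

Lemma sqr_dist_continuous (x0 : 'rV[R]_N) :
  continuous (fun x => euclid (x - x0) ^+ 2).
Proof.
move=> x; under eq_fun do rewrite sqr_euclid.
by apply: (@dotv_continuous (fun y => y - x0) (fun y => y - x0));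
  exact: subr_continuous_rV.
Qed.

Lemma near_euclid_lt (x : 'rV[R]_N) r : 0 < r -> \forall y \near x, euclid (y - x) < r.
Proof.
move=> r0; have := @sqr_dist_continuous x x.
rewrite /continuous_at subrr euclid0 expr0n/= => /cvgr_lt/(_ (r ^+ 2)).
rewrite exprn_gt0// => /(_ isT); apply: filterS => y.
by rewrite ltr_pXn2r ?nnegrE ?euclid_ge0// ltW.
Qed.

Definition eball (x0 : 'rV[R]_N) r : set 'rV[R]_N := [set x | euclid (x - x0) <= r].

Lemma compact_eball x0 r : compact (eball x0 r).
Proof.
apply: bounded_closed_compact.
  exists (`|r| + `|x0|); split; first by rewrite num_real.
  move=> B rB x /= xr; apply: le_trans (ltW rB).
  rewrite -(subrK x0 x) (le_trans (ler_normD _ _))// lerD2r.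
  by rewrite (le_trans (norm_le_euclid _))// (le_trans xr)// ler_norm.
have -> : eball x0 r = if 0 <= r then
   (fun x => euclid (x - x0) ^+ 2) @^-1` [set s | s <= r ^+ 2] else set0.
  case: ifPn => r0; apply/seteqP; split => x //=; rewrite /eball/=.
  - by rewrite ler_pXn2r ?nnegrE ?euclid_ge0.
  - by rewrite ler_pXn2r ?nnegrE ?euclid_ge0.
  - by move/(le_trans (euclid_ge0 _)); rewrite (negbTE r0).
case: ifP => _; last exact: closed0.
by apply: closed_comp => [x _|]; [exact: sqr_dist_continuous|exact: closed_le].
Qed.

End Euclid.

(** * Limits superior, envelopes and extrema *)
Section Limsup.
Context {R : realType} {T : topologicalType}.
Implicit Types (F : set_system T) (g : T -> R) (l : R).

Lemma limf_esup_leP F g l :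
  (limf_esup (fun x => (g x)%:E) F <= l%:E)%E <->
  forall e, 0 < e -> exists2 V, F V & forall x, V x -> g x <= l + e.
Proof.
rewrite limf_esupE; split=> [gl e e0|gl].
  have /ereal_inf_lt[_ [V FV <-] Vlt] :
      (ereal_inf [set ereal_sup ((fun x => (g x)%:E) @` V) | V in F]
         < (l + e)%:E)%E.
    by rewrite (le_lt_trans gl)// lte_fin ltrDl.
  exists V => // x Vx; rewrite -lee_fin (le_trans _ (ltW Vlt))//.
  by apply: ereal_sup_ubound; exists x.
apply/lee_addgt0Pr => e e0; have [V FV Vg] := gl _ e0.
apply: (@le_trans _ _ (ereal_sup ((fun x => (g x)%:E) @` V))).
  by apply: ereal_inf_lbound; exists V.
by apply: ge_ereal_sup => _ [x Vx <-]; rewrite -EFinD lee_fin Vg.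
Qed.

Lemma limf_einf_geP F g l :
  (l%:E <= limf_einf (fun x => (g x)%:E) F)%E <->
  forall e, 0 < e -> exists2 V, F V & forall x, V x -> l - e <= g x.
Proof.
have -> : (l%:E <= limf_einf (fun x => (g x)%:E) F)%E =
    (limf_esup (fun x => (- g x)%:E) F <= (- l)%:E)%E.
  by rewrite /limf_einf leeNr EFinN.
rewrite limf_esup_leP; split=> gl e e0; have [V FV Vg] := gl _ e0;
  exists V => // x /Vg; lra.
Qed.

End Limsup.

Section Envelopes.
Context {R : realType} {N : nat}.
Implicit Types (u v : 'rV[R]_N -> R) (D : set 'rV[R]_N).

Lemma lsc_envE v x : lsc_env v x = - usc_env (fun y => - v y) x.
Proof. by rewrite /lsc_env /usc_env /limf_einf fineN. Qed.

(** The local bound makes the limit superior finite, so that [fine] loses no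
information; [u x] itself is a lower bound since neighbourhoods contain [x]. *)
Lemma usc_env_leP u x l : (exists M, \forall y \near x, u y <= M) ->
  usc_env u x <= l <->
  forall e, 0 < e -> \forall y \near x, u y <= l + e.
Proof.
move=> [M uM]; rewrite /usc_env.
set L := limf_esup _ _.
have Lfin : L \is a fin_num.
  rewrite fin_real//; apply/andP; split.
    apply: (@lt_le_trans _ _ (u x)%:E); first by rewrite ltNyr.
    apply: le_ereal_inf_tmp => _ [V xV <-].
    by apply: ereal_sup_ubound; exists x => //; exact: nbhs_singleton.
  apply: (@le_lt_trans _ _ (M)%:E); last by rewrite ltry.
  apply/limf_esup_leP => e e0; exists [set y | u y <= M] => // y /= yM.
  by rewrite (le_trans yM)// lerDl ltW.
rewrite -lee_fin fineK// limf_esup_leP; split => ul e /ul => [[V xV Vu]|ue].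
  by apply: filterS xV.
by exists [set y | u y <= l + e].
Qed.

Lemma usc_env_usc u x a : (exists M, \forall y \near x, u y <= M) ->
  usc_env u x < a -> \forall y \near x, usc_env u y <= a.
Proof.
move=> uM xa.
have /(usc_env_leP _ uM)/(_ (a - usc_env u x)) := lexx (usc_env u x).
rewrite subr_gt0 => /(_ xa); rewrite addrC subrK => /nbhs_interior.
apply: filterS => y ya; apply/usc_env_leP; first by exists a.
by move=> e e0; apply: filterS ya => z za; rewrite (le_trans za)// lerDl ltW.
Qed.

(** Were the supremum not attained, the sets [{g > g x}] would form a filter
base on [K]; at a cluster point [p] semicontinuity keeps [g] below some value
that [g] exceeds on a member of the filter. *)
Lemma compact_usc_max (T : topologicalType) (K : set T) (g : T -> R) :
  compact K -> K !=set0 ->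
  (forall x a, K x -> g x < a -> \forall y \near x, K y -> g y <= a) ->
  exists2 x, K x & forall y, K y -> g y <= g x.
Proof.
move=> cK [k0 Kk0] uscg; apply: contrapT => nomax.
have bigger x : K x -> exists2 y, K y & g x < g y.
  move=> Kx; apply: contrapT => nob; apply: nomax; exists x => // y Ky.
  by rewrite leNgt; apply/negP => xy; apply: nob; exists y.
pose F := filter_from K (fun x => K `&` [set y | g x < g y]).
have FF : ProperFilter F.
  apply: filter_from_proper; last by move=> x /bigger[y Ky xy]; exists y.
  apply: filter_from_filter; first by exists k0.
  move=> i j Ki Kj; have [ij|ji] := leP (g i) (g j).
    by exists j => // y [Ky /= jy]; split; split=> //=; rewrite (le_lt_trans ij).
  exists i => // y [Ky /= iy]; split; split=> //=; exact: lt_trans iy.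
have FK : F K by exists k0 => // y [].
have [p [Kp clp]] := cK F FF FK.
have [y Ky py] := bigger p Kp.
have Fy : F (K `&` [set z | (g p + g y) / 2 < g z]).
  have [y' Ky' yy'] := bigger y Ky.
  exists y => // z [Kz /= yz]; split => //=; exact: lt_trans (midf_lt py).2 yz.
have near_p' := uscg p _ Kp (midf_lt py).1.
have [z [[Kz /= zgt] /(_ Kz)]] := clp _ _ Fy near_p'.
by rewrite leNgt zgt.
Qed.

End Envelopes.

(** * Distance to the boundary *)
Section Distance.
Context {R : realType} {N : nat}.
Implicit Types (D : set 'rV[R]_N) (x y : 'rV[R]_N).

(** The trace of [D] on the segment would otherwise be a nonempty proper
clopen subset of it. *)
Lemma segment_meets_boundary D x y : D x -> ~ D y ->
  exists2 t : R, 0 <= t <= 1 & boundary D (x + t *: (y - x)).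
Proof.
move=> Dx Dy; apply: contrapT => nobd.
pose p (t : R) := x + t *: (y - x).
have cp : continuous p.
  move=> t; apply: (@cvgD _ _ _ (nbhs t) (nbhs_filter t)); first exact: cvg_cst.
  by apply: cvgZr_tmp; exact: cvg_id.
have cI : connected `[(0 : R), 1] by apply: segment_connected.
have bd t : `[(0 : R), 1]%classic t -> ~ boundary D (p t).
  by rewrite /= in_itv/= => t01 bt; apply: nobd; exists t.
have I0 : `[(0 : R), 1]%classic 0 by rewrite /= in_itv/= lexx ler01.
have I1 : `[(0 : R), 1]%classic 1 by rewrite /= in_itv/= lexx ler01.
have D_int t : `[(0 : R), 1]%classic t -> closure D (p t) -> D° (p t).
  by move=> It clt; apply: contrapT => nint; exact: (bd t It (conj clt nint)).
suff eqI : `[(0 : R), 1]%classic `&` p @^-1` D = `[(0 : R), 1]%classic.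
  move: I1; rewrite -eqI => -[_]; by rewrite /= /p scale1r addrC subrK.
apply: cI.
- by exists 0; split => //=; rewrite /p scale0r addr0.
- exists (p @^-1` D°).
    by apply: open_comp => [t _|]; [exact: cp|exact: open_interior].
  apply/seteqP; split => t [It] /=; last by move/interior_subset.
  by move=> Dt; split => //; apply: D_int => //; exact: subset_closure.
- exists (p @^-1` (closure D)).
    by apply: closed_comp => [t _|]; [exact: cp|exact: closed_closure].
  apply/seteqP; split => t [It] /=; first by move/subset_closure.
  by move=> /(D_int _ It)/interior_subset.
Qed.

Lemma dist_bd_le D x y : boundary D y -> dist_bd D x <= euclid (x - y).
Proof.
move=> By; apply: ge_inf; last by exists y.
by exists 0 => _ [z _ <-]; exact: euclid_ge0.
Qed.

Lemma le_dist_bd D x r : boundary D !=set0 ->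
  (forall y, boundary D y -> r <= euclid (x - y)) -> r <= dist_bd D x.
Proof.
move=> [y0 By0] rle; apply: lb_le_inf; first by exists (euclid (x - y0)), y0.
by move=> _ [y By <-]; exact: rle.
Qed.

Lemma dist_bd_lipschitz D x y : boundary D !=set0 ->
  dist_bd D x <= dist_bd D y + euclid (x - y).
Proof.
move=> B0; rewrite -lerBlDr; apply: le_dist_bd => // z Bz.
rewrite lerBlDr (le_trans (dist_bd_le _ Bz))//.
have -> : x - z = (y - z) + (x - y) by rewrite [RHS]addrC addrA subrK.
exact: euclidD.
Qed.

(** A boundary point lies outside the open set [D], hence outside a ball of
the sup norm around [x], which the Euclidean norm dominates. *)
Lemma dist_bd_gt0 D x : open D -> boundary D !=set0 -> D x -> 0 < dist_bd D x.
Proof.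
move=> oD B0 Dx.
have /nbhs_ballP[r /= r0 rD] : nbhs x D by exact: open_nbhs_nbhs.
apply: (lt_le_trans r0); apply: le_dist_bd => // y [_].
rewrite (interior_id _).1// => nDy; rewrite leNgt; apply/negP => xy; apply: nDy.
by apply: rD; rewrite -ball_normE /= (le_lt_trans (norm_le_euclid _)).
Qed.

(** A constant vector of large entries lies outside the bounded set, and the
segment from [x] to it meets the boundary. *)
Lemma boundary_bounded_neq0 D x : (0 < N)%N -> bounded_set D -> D x ->
  boundary D !=set0.
Proof.
move=> N0 [M [Mreal bM]] Dx.
have [t _ Bt] : exists2 t : R, 0 <= t <= 1 &
    boundary D (x + t *: (const_mx (`|M| + 2) - x)); last by exists (x + t *: (const_mx (`|M| + 2) - x)).
apply: segment_meets_boundary => // /(bM (`|M| + 1)).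
have -> : M < `|M| + 1 by rewrite (le_lt_trans (ler_norm M))// ltrDl.
move=> /(_ isT).
apply/negP; rewrite -ltNge.
rewrite [ltRHS]/Num.norm/= mx_normrE.
apply: lt_le_trans (le_bigmax _ _ (0, Ordinal N0)) => /=.
by rewrite mxE [ltRHS]ger0_norm ?addr_ge0// ltrD2l ltr1n.
Qed.

Lemma eball_sub D x r : D x -> r < dist_bd D x -> eball x r `<=` D.
Proof.
move=> Dx rd y xy; apply: contrapT => nDy.
have [t /andP[t0 t1] Bt] := segment_meets_boundary Dx nDy.
have := dist_bd_le x Bt; apply/negP; rewrite -ltNge (le_lt_trans _ rd)//.
rewrite opprD addrA subrr sub0r -scaleN1r scalerA euclidZ mulN1r normrN ger0_norm//.
by rewrite (le_trans _ xy)// ler_piMl ?euclid_ge0.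
Qed.

End Distance.

(** * Real powers *)
Section Powers.
Context {R : realType}.
Implicit Types (a b e k r s t x y : R).

Lemma powR_continuous x a : 0 < a -> {for a, continuous (fun t => t `^ x)}.
Proof.
move=> a0; apply: differentiable_continuous; apply/derivable1_diffP.
by apply: derivable_powR; rewrite in_itv/= a0.
Qed.

Lemma le_powR_base a b x : 0 <= x -> 0 <= a -> a <= b -> a `^ x <= b `^ x.
Proof.
by move=> x0 a0 ab; apply: ge0_ler_powR; rewrite ?nnegrE// (le_trans a0).
Qed.

Lemma lt_powR_base a b x : 0 < x -> 0 <= a -> a < b -> a `^ x < b `^ x.
Proof.
by move=> x0 a0 ab; apply: gt0_ltr_powR; rewrite ?nnegrE// (le_trans a0)// ltW.
Qed.

Lemma powRD_gt0 a x y : 0 < a -> a `^ (x + y) = a `^ x * a `^ y.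
Proof. by move=> a0; rewrite powRD// (gt_eqF a0) implybT. Qed.

Lemma continuous0_param (F : R -> R) e : {for 0, continuous F} -> 0 < e ->
  exists2 t, 0 < t < 1 & `|F 0 - F t| < e.
Proof.
move=> cF e0; have /nbhs_ballP[r /= r0 rF] : \forall t \near 0, `|F 0 - F t| < e.
  exact: (@cvgr_dist_lt _ _ _ (nbhs (0 : R)) (nbhs_filter _) F (F 0) cF).
have h1 : 1 / 2 < 1 :> R by lra.
have h2 : r / 2 < r by move: r0; clear; lra.
exists (Num.min (r / 2) (1 / 2)).
  by rewrite lt_min !divr_gt0//= gt_min h1 orbT.
apply: rF; rewrite /ball/= sub0r normrN ger0_norm ?le_min ?divr_ge0 ?(ltW r0)//.
by rewrite gt_min h2.
Qed.

Lemma powR_small k e (K : R) : 0 < k -> 0 < e -> 0 <= K ->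
  exists2 s, 0 < s & forall r, 0 < r < s -> K * r `^ k <= e.
Proof.
move=> k0 e0 K0; have K10 : 0 < K + 1 by rewrite ltr_wpDl.
exists ((e / (K + 1)) `^ (1 / k)); first by rewrite powR_gt0// divr_gt0.
move=> r /andP[r0 rs].
have : r `^ k <= e / (K + 1).
  have eE : e / (K + 1) = ((e / (K + 1)) `^ (1 / k)) `^ k.
    by rewrite -powRrM div1r mulVf ?gt_eqF// powRr1// divr_ge0// ltW.
  by rewrite eE; apply: ge0_ler_powR; rewrite ?nnegrE ?powR_ge0// ltW.
move=> /(ler_wpM2l K0)/le_trans; apply.
by rewrite mulrCA ler_piMr ?(ltW e0)// ler_pdivrMr// mul1r lerDl.
Qed.

(** The parameter [t] is both the excess over [l] in the bound on the source
and the relative radius of the ball used around a point; both losses disappear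
as [t] tends to [0]. *)
Lemma param_above (l a b e : R) : 0 < l -> 0 < e ->
  exists2 t, 0 < t < 1 & (l + t) `^ a * (1 - t) `^ b <= l `^ a + e.
Proof.
move=> l0 e0; pose F t := (l + t) `^ a * (1 - t) `^ b.
have cF : {for 0, continuous F}.
  apply: (@cvgM _ _ (nbhs (0 : R)) (nbhs_filter _)).
    apply: (@continuous_comp _ _ _ (fun t => l + t) (fun t => t `^ a)).
      by apply: cvgD; [exact: cvg_cst|exact: cvg_id].
    by apply: powR_continuous; rewrite addr0.
  apply: (@continuous_comp _ _ _ (fun t => 1 - t) (fun t => t `^ b)).
    by apply: cvgB; [exact: cvg_cst|exact: cvg_id].
  by apply: powR_continuous; rewrite subr0.
have [t t01 Ft] := continuous0_param cF e0; exists t => //.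
have F0 : F 0 = l `^ a by rewrite /F addr0 subr0 powR1 mulr1.
move: Ft; rewrite distrC F0 => /(le_lt_trans (ler_norm _)).
by rewrite ltrBlDl => /ltW.
Qed.

Lemma param_below (l b c : R) : 0 < c < l ->
  exists2 t, 0 < t < 1 & c <= (l - t) * (1 + t) `^ b.
Proof.
move=> /andP[c0 cl]; pose F t := (l - t) * (1 + t) `^ b.
have cF : {for 0, continuous F}.
  apply: (@cvgM _ _ (nbhs (0 : R)) (nbhs_filter _)).
    by apply: cvgB; [exact: cvg_cst|exact: cvg_id].
  apply: (@continuous_comp _ _ _ (fun t => 1 + t) (fun t => t `^ b)).
    by apply: cvgD; [exact: cvg_cst|exact: cvg_id].
  by apply: powR_continuous; rewrite addr0.
have lc : 0 < l - c by rewrite subr_gt0.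
have [t t01 Ft] := continuous0_param cF lc.
exists t => //; have F0 : F 0 = l by rewrite /F addr0 subr0 powR1 mulr1.
move: Ft; rewrite F0 => /(le_lt_trans (ler_norm _)).
by rewrite ltrD2l ltrN2 => /ltW.
Qed.

End Powers.


(** * Traces, expansions and interior lower bounds *)
Section Barriers.
Context {R : realType} {N : nat}.
Implicit Types (D : set 'rV[R]_N) (x y p : 'rV[R]_N) (A : 'rV[R]_N -> 'M[R]_N)
  (f u v : 'rV[R]_N -> R) (m c T M rho : R).

Lemma mxtrace_otimes_delta (B : 'M[R]_N) (i : 'I_N) :
  \tr (B *m otimes (delta_mx 0 i) (delta_mx 0 i)) = B i i.
Proof.
by rewrite /otimes mulmxA mxtrace_mulC mulmxA -rowE trmx_delta -colE trace_mx11 !mxE.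
Qed.

(** Test the quadratic form on the coordinate vectors. *)
Lemma mxtrace_le (B : 'M[R]_N) T :
  (forall xi, euclid xi = 1 -> \tr (B *m otimes xi xi) <= T) -> \tr B <= N%:R * T.
Proof.
move=> BT; rewrite mulr_natl -[N in leRHS]card_ord -sumr_const; apply: ler_sum => i _.
by rewrite -mxtrace_otimes_delta BT// euclid_delta.
Qed.

Lemma mxtrace_mul_scalar (B : 'M[R]_N) c : \tr (B *m c%:M) = c * \tr B.
Proof. by rewrite mul_mx_scalar mxtraceZ. Qed.

Lemma quadratic_scalar p c z :
  quadratic p c%:M z = dotv p z + c / 2 * euclid z ^+ 2.
Proof. by rewrite /quadratic mul_mx_scalar dotvZl sqr_euclid mulrA (mulrC c). Qed.

Lemma sqr_euclid_shift x0 x y : euclid (y - x0) ^+ 2 =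
  euclid (x - x0) ^+ 2 + 2 * dotv (x - x0) (y - x) + euclid (y - x) ^+ 2.
Proof.
have -> : y - x0 = (x - x0) + (y - x) by rewrite [RHS]addrC addrA subrK.
move: (x - x0) (y - x) => a b.
by rewrite !sqr_euclid dotvDl !dotvDr (dotvC b a); ring.
Qed.

Lemma near_eball x0 x rho : euclid (x - x0) < rho ->
  \forall y \near x, euclid (y - x0) < rho.
Proof.
move=> xr; have := @near_euclid_lt _ _ x (rho - euclid (x - x0)).
rewrite subr_gt0 => /(_ xr); apply: filterS => y yx.
have -> : y - x0 = (y - x) + (x - x0) by rewrite addrA subrK.
by rewrite (le_lt_trans (euclidD _ _))// -ltrBrDr.
Qed.

(** A one-sided Taylor bound with a crude quadratic remainder replaces second
derivatives of the barrier: it makes an explicit paraboloid touch from above.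
The constant grows by the factor needed to absorb one more [1 / (1 - s)],
which [|s| <= 1/2] keeps bounded. *)
Lemma inv_pow_taylor n : exists2 C : R, 0 <= C & forall s : R, `|s| <= 1 / 2 ->
  ((1 - s) ^+ n)^-1 <= 1 + n%:R * s + C * s ^+ 2.
Proof.
elim: n => [|n [C C0 IH]].
  by exists 0 => // s _; rewrite expr0 invr1 !mul0r !addr0.
have n0 : 0 <= n%:R :> R by [].
exists (2 * C + n%:R * 2 + 2); first lra.
move=> s s2; have s2' := s2; move: s2'; rewrite ler_norml => /andP[sl sr].
have s1 : 0 < 1 - s by lra.
rewrite exprS invfM ler_pdivrMl//.
apply: (le_trans (IH _ s2)); rewrite -[n.+1]addn1 natrD.
have ss := sqr_ge0 s; set k := n%:R in n0 *.
rewrite -subr_ge0 (_ : _ - _ = s ^+ 2 * ((C + 2 * k + 2) - k - 1 - s * (2 * C + k * 2 + 2))); last by ring.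
apply: mulr_ge0 => //.
have : s * (2 * C + k * 2 + 2) <= 1 / 2 * (2 * C + k * 2 + 2).
  by apply: ler_wpM2r => //; lra.
lra.
Qed.

(** This lets the constant part and the blow-up part of a barrier be treated
separately by the nonlinearity. *)
Lemma powR_superadd a b m : 0 <= a -> 0 <= b -> 1 < m ->
  a `^ m + b `^ m <= (a + b) `^ m.
Proof.
move=> a0 b0 m1; have m0 : 0 < m by lra.
rewrite -!(@mulr_powRB1 _ _ m)// ?addr_ge0// mulrDl.
have mono c d : 0 <= c -> c <= d -> c `^ (m - 1) <= d `^ (m - 1).
  by move=> c0 cd; apply: ge0_ler_powR; rewrite ?nnegrE ?subr_ge0 ?(ltW m1)//; lra.
by apply: lerD; apply: ler_wpM2l => //; apply: mono => //; lra.
Qed.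

Lemma lsc_env_ge0 D v x : open D -> D x -> (forall y, D y -> 0 <= v y) ->
  0 <= lsc_env v x.
Proof.
move=> oD Dx v0; have nv : \forall y \near x, - v y <= 0.
  by apply: filterS (open_nbhs_nbhs (conj oD Dx)) => y /v0; rewrite oppr_le0.
rewrite lsc_envE oppr_ge0; apply/usc_env_leP; first by exists 0.
by move=> e e0; apply: filterS nv => y yv; rewrite (le_trans yv)// addr_ge0// ltW.
Qed.

(** Interior lower bound. The paraboloid with value [M] at [x0] that vanishes
on the sphere lies below [v] there, because [v] is nonnegative. If it exceeds
[v] at [x0], then sliding it down to the last contact gives an interior contact
point, where the Hessian [- 2 M / rho^2] of the paraboloid can be tested in the
equation; the value of [v] at that point is at most [v x0]. *)
Lemma viscosity_super_ball D A m f v T x0 rho M c : open D -> 0 < m ->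
  (forall x, D x -> \tr (A x) <= T) ->
  viscosity_super D A m f v -> (forall x, D x -> 0 <= v x) ->
  0 < rho -> 0 <= M -> eball x0 rho `<=` D ->
  (forall y, eball x0 rho y -> c <= f y) ->
  M <= lsc_env v x0 \/ c - 2 * M * T / rho ^+ 2 <= lsc_env v x0 `^ m.
Proof.
move=> oD m0 trT [vb vsuper] v0 rho0 M0 BD cf.
have [|vM] := leP M (lsc_env v x0); [by left|right].
have r2 : 0 < rho ^+ 2 by rewrite exprn_gt0.
set k := M / rho ^+ 2; have k0 : 0 <= k by rewrite divr_ge0// ltW.
pose g y := - lsc_env v y - k * euclid (y - x0) ^+ 2.
have Bx0 : eball x0 rho x0 by rewrite /eball/= subrr euclid0 ltW.
have nvb x : D x -> exists K, \forall y \near x, - v y <= K.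
  by move=> /vb[K vK]; exists (- K); apply: filterS vK => y; rewrite lerN2.
have uscg x a : eball x0 rho x -> g x < a ->
    \forall y \near x, eball x0 rho y -> g y <= a.
  move=> Bx gxa; have Dx := BD _ Bx.
  pose e := (a - g x) / 2.
  have e0 : 0 < e by rewrite divr_gt0// subr_gt0.
  have n1 : \forall y \near x, - lsc_env v y <= - lsc_env v x + e.
    have := @usc_env_usc _ _ (fun y => - v y) x (- lsc_env v x + e) (nvb _ Dx).
    rewrite lsc_envE opprK ltrDl => /(_ e0).
    by apply: filterS => y; rewrite lsc_envE opprK.
  have cq : k * euclid (y - x0) ^+ 2 @[y --> x] --> k * euclid (x - x0) ^+ 2.
    by apply: (@cvgMl_tmp _ _ (nbhs x) (nbhs_filter x)); exact: sqr_dist_continuous.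
  have n2 : \forall y \near x, k * euclid (x - x0) ^+ 2 - e < k * euclid (y - x0) ^+ 2.
    by apply: (cvgr_gt _ cq); rewrite ltrBlDr ltrDl.
  apply: filterS2 n1 n2 => y; rewrite /e /g => *; lra.
have [x1 Bx1 maxx1] :=
  compact_usc_max (@compact_eball _ _ x0 rho) (ex_intro _ x0 Bx0) uscg.
have Dx1 := BD _ Bx1.
have x1_int : euclid (x1 - x0) < rho.
  rewrite lt_neqAle [X in _ && X]Bx1 andbT; apply/eqP => x1r.
  have := maxx1 _ Bx0; rewrite /g x1r subrr euclid0 expr0n/= mulr0 divfK ?gt_eqF//.
  have := lsc_env_ge0 oD Dx1 v0; lra.
have x1x0 : lsc_env v x1 <= lsc_env v x0.
  have := maxx1 _ Bx0; rewrite /g subrr euclid0 expr0n/= mulr0.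
  have : 0 <= k * euclid (x1 - x0) ^+ 2 by rewrite mulr_ge0// sqr_ge0.
  lra.
have jet : subjet (lsc_env v) x1 (- (2 * k) *: (x1 - x0)) (- (2 * k))%:M.
  split=> [|e e0]; first by rewrite tr_scalar_mx.
  apply: filterS (near_eball x1_int) => y /ltW /maxx1; rewrite /g.
  rewrite quadratic_scalar dotvZl (sqr_euclid_shift x0 x1 y).
  have : 0 <= e * euclid (y - x1) ^+ 2 by rewrite mulr_ge0 ?sqr_ge0// ltW.
  move: (euclid _ ^+ 2) (dotv _ _) (euclid (x1 - x0) ^+ 2) => P Q S.
  lra.
have := vsuper _ _ _ Dx1 jet.
rewrite mxtrace_mul_scalar => vx1.
have vmono : lsc_env v x1 `^ m <= lsc_env v x0 `^ m.
  by apply: ge0_ler_powR; rewrite ?nnegrE ?(lsc_env_ge0 oD _ v0)//; [exact: ltW|exact: BD].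
have trA : 2 * k * \tr (A x1) <= 2 * k * T by rewrite ler_wpM2l ?trT// mulr_ge0.
have -> : 2 * M * T / rho ^+ 2 = 2 * k * T by rewrite /k mulrAC -!mulrA.
move: vx1; rewrite mulNr opprK => vx1; move: (cf _ Bx1) => cf1.
rewrite lerBlDl; apply: (le_trans cf1); apply: (le_trans vx1); exact: lerD.
Qed.

End Barriers.

(** * Interior upper bounds *)
Section KellerOsserman.
Context {R : realType} {N : nat}.
Implicit Types (D : set 'rV[R]_N) (x y p : 'rV[R]_N) (A : 'rV[R]_N -> 'M[R]_N)
  (f u v : 'rV[R]_N -> R) (m c T M rho : R).

(** At the contact point the equation bounds [z^(m-1)] by [B / t^2]; the
weight [t^n] absorbs the singular factor as soon as [n (m-1) >= 2]. *)
Lemma ko_exponent (m B t z : R) n : 1 < m -> 0 <= B -> 0 < t <= 1 -> 0 < z ->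
  2 <= n%:R * (m - 1) ->
  z `^ m <= B / t ^+ 2 * z -> z * t ^+ n <= B `^ (1 / (m - 1)).
Proof.
move=> m1 B0 /andP[t0 t1] z0 nm; have m10 : 0 < m - 1 by rewrite subr_gt0.
rewrite -(@mulr_powRB1 _ z m) ?(ltW z0)//; last exact: lt_trans m1.
rewrite [leRHS]mulrC ler_pM2l// => zB.
have tn0 : 0 <= t ^+ n by rewrite exprn_ge0// ltW.
have -> : z * t ^+ n = ((z * t ^+ n) `^ (m - 1)) `^ (1 / (m - 1)).
  by rewrite -powRrM div1r mulfV ?gt_eqF// powRr1// mulr_ge0// ltW.
apply: ge0_ler_powR; rewrite ?nnegrE ?powR_ge0// ?divr_ge0// ?(ltW m10)//.
rewrite powRM ?(ltW z0)//.
have tn2 : (t ^+ n) `^ (m - 1) <= t ^+ 2.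
  rewrite -[t ^+ n]powR_mulrn ?(ltW t0)// -powRrM -powR_mulrn ?(ltW t0)//.
  by apply: ger_powR => //; rewrite t0.
apply: (le_trans (ler_pM _ _ zB tn2)); rewrite ?powR_ge0//.
by rewrite divfK// gt_eqF// exprn_gt0.
Qed.

(** Here [h] is the length of the increment, [Q] its inner product with the
position of the contact point relative to the centre, and [s] the relative
decrease of the weight [t]. Cauchy-Schwarz and [h <= rho] give
[s^2 <= 9 h^2 / (rho t1)^2], whence a paraboloid with scalar Hessian. *)
Lemma ko_quadratic_bound (C1 n t1 rho z h Q s : R) :
  0 <= C1 -> 0 <= n -> 0 < t1 <= 1 -> 0 < rho -> 0 <= z -> 0 <= h <= rho ->
  `|Q| <= rho * h -> s = (2 * Q + h ^+ 2) / (rho ^+ 2 * t1) ->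
  z * (1 + n * s + C1 * s ^+ 2) <=
  z + (2 * (z * n / (rho ^+ 2 * t1)) * Q +
       2 * z * (n + 9 * C1) / (rho * t1) ^+ 2 / 2 * h ^+ 2).
Proof.
move=> C10 n0 /andP[t10 t11] rho0 z0 /andP[h0 hr] Qrh sE.
have [a aE] : exists a, a = (rho ^+ 2 * t1)^-1 by eexists.
have [W WE] : exists W, W = ((rho * t1) ^+ 2)^-1 by eexists.
have a0 : 0 <= a by rewrite aE invr_ge0 mulr_ge0 ?sqr_ge0// ltW.
have WaE : W = rho ^+ 2 * a ^+ 2.
  by rewrite WE aE; field; rewrite !gt_eqF.
have aW : a <= W.
  rewrite aE WE lef_pV2 ?posrE ?exprn_gt0 ?mulr_gt0 ?exprn_gt0//.
  by rewrite exprMn ler_wpM2l ?sqr_ge0// expr2 ler_piMl// ltW.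
have s2 : s ^+ 2 <= 9 * W * h ^+ 2.
  have -> : 9 * W * h ^+ 2 = (3 * rho * h * a) ^+ 2 by rewrite WaE; ring.
  rewrite -(real_normK (num_real s)) sE -aE normrM (ger0_norm a0) ler_pXn2r ?nnegrE ?mulr_ge0 ?(ltW rho0)//.
  apply: ler_wpM2r => //; apply: (le_trans (ler_normD _ _)).
  rewrite normrM ger0_norm// (ger0_norm (sqr_ge0 _)).
  have : h ^+ 2 <= rho * h by rewrite expr2 ler_wpM2r.
  rewrite -(mulrA 3); move: Qrh; clear; move: (rho * h) => X; lra.
have k1 : 0 <= z * n * h ^+ 2 * (W - a) by rewrite !mulr_ge0 ?sqr_ge0 ?subr_ge0.
have k2 : 0 <= z * C1 * (9 * W * h ^+ 2 - s ^+ 2) by rewrite !mulr_ge0 ?subr_ge0.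
have k3 : n * s = n * (2 * Q + h ^+ 2) * a by rewrite sE -aE mulrA.
rewrite -aE -WE -subr_ge0.
have -> : z * (1 + n * s + C1 * s ^+ 2) = z + z * (n * s) + z * C1 * s ^+ 2.
  by ring.
rewrite k3.
by apply: le_trans (addr_ge0 k1 k2) _; rewrite le_eqVlt; apply/orP; left;
  apply/eqP; field.
Qed.

(** The Keller-Osserman estimate: superlinearity bounds a subsolution inside
a ball whatever its size near the sphere. With [t = 1 - |y - x0|^2 / rho^2], a
maximum point of [(u - M) t^n] is a contact point of [u] from below with the
barrier [M + S t^(-n)], which is infinite on the sphere. Testing the equation
there, where the constant [M] already compensates the source, leaves
[S^(m-1) <= C / rho^2]. *)
Lemma viscosity_sub_ball D A m T : 1 < m -> 0 <= T ->
  (forall x, D x -> \tr (A x) <= T) ->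
  exists2 C, 0 <= C & forall f u x0 rho M,
    viscosity_sub D A m f u -> 0 < rho -> 0 <= M -> eball x0 rho `<=` D ->
    (forall y, eball x0 rho y -> f y <= M `^ m) ->
    usc_env u x0 <= M + (C / rho ^+ 2) `^ (1 / (m - 1)).
Proof.
move=> m1 T0 trT; have m10 : 0 < m - 1 by rewrite subr_gt0.
(* any exponent with [n (m - 1) >= 2] makes the barrier steep enough *)
pose n := (Num.truncn (2 / (m - 1))).+1.
have nm : 2 <= n%:R * (m - 1).
  by rewrite -ler_pdivrMr// ltW// truncnS_gt.
have n_neq0 : n != 0%N by [].
move: n nm n_neq0 => n nm n_neq0.
have [C1 C10 taylor] := @inv_pow_taylor R n.
have n0 : 0 <= n%:R :> R by [].
have K0 : 0 <= n%:R + 9 * C1 by rewrite addr_ge0// mulr_ge0.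
exists (2 * (n%:R + 9 * C1) * T); first by rewrite !mulr_ge0.
move=> f u x0 rho M [ub usub] rho0 M0 BD fM.
set B := _ / rho ^+ 2; have r2 : 0 < rho ^+ 2 by rewrite exprn_gt0.
have B0 : 0 <= B by apply: divr_ge0 (ltW r2); rewrite !mulr_ge0.
pose t y := 1 - euclid (y - x0) ^+ 2 / rho ^+ 2.
have t_gt0 y : euclid (y - x0) < rho -> 0 < t y.
  move=> By; rewrite subr_gt0 ltr_pdivrMr// mul1r ltr_pXn2r ?nnegrE ?euclid_ge0//.
  exact: ltW.
have t_ge0 y : eball x0 rho y -> 0 <= t y.
  move=> By; rewrite subr_ge0 ler_pdivrMr// mul1r ler_pXn2r ?nnegrE ?euclid_ge0//.
  exact: ltW.
have t_le1 y : t y <= 1 by rewrite gerBl divr_ge0 ?sqr_ge0// ltW.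
have tc : continuous t.
  move=> y; apply: (@cvgB _ _ _ (nbhs y) (nbhs_filter y)); first exact: cvg_cst.
  apply: (@cvgMr_tmp _ _ (nbhs y) (nbhs_filter y)); exact: sqr_dist_continuous.
pose g y := (usc_env u y - M) * t y ^+ n.
have Bx0 : eball x0 rho x0 by rewrite /eball/= subrr euclid0 ltW.
have uscg x a : eball x0 rho x -> g x < a ->
    \forall y \near x, eball x0 rho y -> g y <= a.
  move=> Bx gxa; have Dx := BD _ Bx.
  have [e e0 eE] : exists2 e : R, 0 < e & a = g x + 2 * e.
    exists ((a - g x) / 2); first by rewrite divr_gt0// subr_gt0.
    by rewrite mulrC divfK// addrC subrK.
  have n1 : \forall y \near x, usc_env u y <= usc_env u x + e.
    by apply: usc_env_usc (ub _ Dx) _; rewrite ltrDl.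
  have cq : (usc_env u x + e - M) * t y ^+ n @[y --> x] -->
      (usc_env u x + e - M) * t x ^+ n.
    apply: (@cvgMl_tmp _ _ (nbhs x) (nbhs_filter x)).
    apply: (@continuous_comp _ _ _ t (fun s : R => s ^+ n)); first exact: tc.
    exact: exprn_continuous.
  have lta : (usc_env u x + e - M) * t x ^+ n < a.
    have tn1 : t x ^+ n <= 1 by rewrite exprn_ile1// t_ge0.
    rewrite addrAC mulrDl -/(g x) eE ltrD2l (@le_lt_trans _ _ e)//.
      by rewrite ler_piMr// ltW.
    by rewrite ltr_pMl// ltr1n.
  have n2 : \forall y \near x, (usc_env u x + e - M) * t y ^+ n < a.
    exact: (cvgr_lt _ cq).
  apply: filterS2 n1 n2 => y uy ya By.
  by rewrite (le_trans _ (ltW ya))// ler_wpM2r ?exprn_ge0 ?t_ge0// lerD2r.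
have [x1 Bx1 maxx1] :=
  compact_usc_max (@compact_eball _ _ x0 rho) (ex_intro _ x0 Bx0) uscg.
have gx0 : g x0 = usc_env u x0 - M.
  by rewrite /g /t subrr euclid0 expr0n/= mul0r subr0 expr1n mulr1.
rewrite -lerBlDl -gx0.
have [gx00|gx0_gt0] := leP (g x0) 0; first by rewrite (le_trans gx00)// powR_ge0.
apply: (le_trans (maxx1 _ Bx0)).
have gx1_gt0 : 0 < g x1 by rewrite (lt_le_trans gx0_gt0)// maxx1.
have t1 : 0 < t x1.
  rewrite lt_neqAle t_ge0// andbT; apply/eqP => t10.
  by move: gx1_gt0; rewrite /g -t10 expr0n (negbTE n_neq0) mulr0 ltxx.
have tn1 : 0 < t x1 ^+ n by rewrite exprn_gt0.
set z := usc_env u x1 - M.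
have z0 : 0 < z by rewrite -(pmulr_lgt0 _ tn1).
apply: ko_exponent => //; first by rewrite t1 t_le1.
have x1_int : euclid (x1 - x0) < rho.
  move: t1; rewrite subr_gt0 ltr_pdivrMr// mul1r ltr_pXn2r ?nnegrE ?euclid_ge0//.
  exact: ltW.
have uE : usc_env u x1 = M + z by rewrite /z addrC subrK.
set k := z * n%:R / (rho ^+ 2 * t x1).
set c := 2 * z * (n%:R + 9 * C1) / (rho * t x1) ^+ 2.
(* [2 k (x1 - x0)] and [c] are the gradient and the scalar Hessian read off
   from the quadratic bound of the barrier. *)
have jet : superjet (usc_env u) x1 ((2 * k) *: (x1 - x0)) c%:M.
  split=> [|e e0]; first by rewrite tr_scalar_mx.
  have tx1c : t y @[y --> x1] --> t x1 by exact: tc.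
  have near_s : \forall y \near x1, `|t x1 - t y| < t x1 / 2.
    by apply: (@cvgr_dist_lt _ _ _ (nbhs x1) (nbhs_filter x1) t (t x1) tx1c); rewrite divr_gt0.
  have near_h := near_euclid_lt x1 rho0.
  apply: filterS3 near_s near_h (near_eball x1_int) => y ts hr yr.
  rewrite quadratic_scalar dotvZl.
  have ty := t_gt0 _ yr.
  pose s := (t x1 - t y) / t x1.
  have tyE : t y = t x1 * (1 - s).
    by rewrite /s mulrBr mulr1 mulrC divfK ?gt_eqF// opprB addrC subrK.
  have s2 : `|s| <= 1 / 2.
    rewrite normrM normfV (gtr0_norm t1) ler_pdivrMr// ltW//.
    by rewrite mul1r mulrC.
  have uy : usc_env u y <= M + z * ((1 - s) ^+ n)^-1.
    have s1 : 0 < 1 - s by rewrite -(pmulr_rgt0 _ t1) -tyE.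
    rewrite -lerBlDl ler_pdivlMr ?exprn_gt0// -(ler_pM2r tn1) -mulrA -exprMn.
    by rewrite (mulrC (1 - s)) -tyE; exact: maxx1 _ (ltW yr).
  apply: (le_trans uy); rewrite uE -!addrA lerD2l.
  apply: le_trans (ler_wpM2l (ltW z0) (taylor _ s2)) _.
  rewrite !addrA; apply: ler_wpDr; first by rewrite mulr_ge0 ?sqr_ge0// ltW.
  rewrite -addrA; apply: ko_quadratic_bound => //.
  - by rewrite t1 t_le1.
  - exact: ltW.
  - by rewrite euclid_ge0 ltW.
  - rewrite (le_trans (abs_dotv_le _ _))// ler_wpM2r ?euclid_ge0//; exact: ltW.
  - rewrite /s invfM mulrA; congr (_ / _); rewrite /t (sqr_euclid_shift x0 x1 y).
    by move: (euclid (x1 - x0)) (euclid (y - x1)) (dotv _ _) => a b c0; ring.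
have := usub _ _ _ (BD _ Bx1) jet; rewrite mxtrace_mul_scalar => ux1.
have sup := powR_superadd M0 (ltW z0) m1.
have c0 : 0 <= c.
  by rewrite divr_ge0 ?sqr_ge0// !mulr_ge0// ltW.
have trA : c * \tr (A x1) <= c * T by rewrite ler_wpM2l ?trT//; exact: BD.
have -> : B / t x1 ^+ 2 * z = c * T.
  rewrite /B /c; move: (t x1) (n%:R + _) t1 => t' K t'0; move: (z) => z'.
  by field; rewrite !gt_eqF.
rewrite -uE in sup; have fx1 := fM _ Bx1.
have : M `^ m + z `^ m <= M `^ m + c * T.
  apply: (le_trans sup); move: ux1; rewrite addrC lerBlDr => /le_trans; apply.
  exact: lerD.
by rewrite lerD2l.
Qed.

End KellerOsserman.

(** * Boundedness of the corrector *)
Section Corrector.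
Context {R : realType} {N : nat}.
Implicit Types (D : set 'rV[R]_N) (x y p xi : 'rV[R]_N) (A : 'rV[R]_N -> 'M[R]_N).

Lemma derive_lipschitz (g : 'rV[R]_N -> R) x xi : derivable g x xi ->
  (forall y z, g y <= g z + euclid (y - z)) -> `|'D_xi g x| <= euclid xi.
Proof.
move=> dg lip; rewrite /derive.
have /cvg_norm cg := dg.
rewrite -(cvg_lim _ cg)//; apply: limr_le; first by apply/cvg_ex; eexists; exact: cg.
apply: nearW => h /=; have [->|h0] := eqVneq h 0.
  by rewrite invr0 scale0r normr0 euclid_ge0.
rewrite normrM normfV ler_pdivrMl ?normr_gt0// -euclidZ.
have := lip (h *: xi + x) x; have := lip x (h *: xi + x).
rewrite (euclidBC x) addrK => l1 l2.
by rewrite ler_distl lerBlDr l1 l2.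
Qed.

Lemma mxtrace_otimesZ (B : 'M[R]_N) a xi :
  \tr (B *m otimes (a *: xi) (a *: xi)) = a ^+ 2 * \tr (B *m otimes xi xi).
Proof.
rewrite /otimes -scalemxAr [(_ *: _)^T]linearZ/= -scalemxAl scalerA -scalemxAr.
by rewrite mxtraceZ expr2.
Qed.

(** Each partial derivative of the distance is at most [1] in absolute value;
this crude bound on the gradient suffices for boundedness of the quadratic form
evaluated on it. *)
Lemma normal_diffusion_bounds D A x (Lam : R) : differentiable (dist_bd D) x ->
  boundary D !=set0 ->
  (forall xi, euclid xi = 1 -> 0 <= \tr (A x *m otimes xi xi) <= Lam) ->
  0 <= Lam -> 0 <= normal_diffusion D A x <= N%:R * Lam.
Proof.
move=> dd B0 bnd L0; rewrite /normal_diffusion; set g := grad _ _.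
have gN : euclid g ^+ 2 <= N%:R.
  rewrite sqr_euclid /dotv -[N in leRHS]card_ord -sum1_card natr_sum.
  apply: ler_sum => i _; rewrite -expr2 -real_normK ?num_real// expr_le1//.
  rewrite mxE -(euclid_delta i); apply: derive_lipschitz.
    exact: diff_derivable.
  by move=> y z; exact: dist_bd_lipschitz.
have [g0|gneq0] := eqVneq (euclid g) 0.
  have -> : g = 0.
    apply/rowP => i; apply/eqP; rewrite [X in _ == X]mxE.
    by have := abs_coord_le_euclid g i; rewrite g0 normr_le0.
  by rewrite /otimes trmx0 mul0mx mulmx0 mxtrace0 lexx mulr_ge0.
have gE : g = euclid g *: ((euclid g)^-1 *: g) by rewrite scalerA mulfV// scale1r.
have g1 : euclid ((euclid g)^-1 *: g) = 1.
  by rewrite euclidZ ger0_norm ?invr_ge0 ?euclid_ge0// mulVf.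
have -> : \tr (A x *m otimes g g) =
    euclid g ^+ 2 * \tr (A x *m otimes ((euclid g)^-1 *: g) ((euclid g)^-1 *: g)).
  by rewrite {1 2}gE mxtrace_otimesZ.
have /andP[tr0 trL] := bnd _ g1.
by rewrite mulr_ge0 ?sqr_ge0//= ler_pM ?sqr_ge0.
Qed.

End Corrector.

(** * Boundary rates *)
Section BoundaryRate.
Context {R : realType} {N : nat}.
Context (D : set 'rV[R]_N) (A : 'rV[R]_N -> 'M[R]_N) (m q T : R)
  (f : 'rV[R]_N -> R).
Context (openD : open D) (bd0 : boundary D !=set0) (T0 : 0 <= T)
  (trT : forall x, D x -> \tr (A x) <= T) (m1 : 1 < m)
  (q_gt : 2 * m / (m - 1) < q).
Local Notation d := (dist_bd D).

Lemma inner_ball x t : D x -> 0 < t < 1 ->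
  [/\ 0 < d x, eball x (t * d x) `<=` D &
   forall y, eball x (t * d x) y -> (1 - t) * d x <= d y <= (1 + t) * d x].
Proof.
move=> Dx /andP[t0 t1]; have dx0 := dist_bd_gt0 openD bd0 Dx.
have td : t * d x < d x by rewrite gtr_pMl.
split=> // [|y xy]; first exact: eball_sub Dx td.
have := dist_bd_lipschitz x y bd0; have := dist_bd_lipschitz y x bd0.
rewrite (euclidBC x) => l1 l2; rewrite mulrBl mulrDl mul1r lerBlDr.
by rewrite (le_trans l1) ?lerD2l// (le_trans l2) ?lerD2l.
Qed.

Let m0 : 0 < m. Proof. exact: lt_trans m1. Qed.
Let m10 : 0 < m - 1. Proof. by rewrite subr_gt0. Qed.
Let q0 : 0 < q.
Proof. by apply: lt_trans q_gt; rewrite divr_gt0// mulr_gt0. Qed.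

(** In the ball of radius [t d(x)] around [x] the distance is at least
[(1 - t) d(x)], so the source is at most [(l + t) ((1 - t) d(x))^(-q) = M^m].
The Keller-Osserman estimate adds to [M] a term of order [d(x)^(-2/(m-1))],
which [d(x)^(q/m)] sends to [0] because [q/m > 2/(m-1)]. *)
Lemma sub_rate l u e : 0 < l -> 0 < e ->
  (forall e, 0 < e -> exists2 s, 0 < s &
     forall x, D x -> d x < s -> f x * d x `^ q <= l + e) ->
  viscosity_sub D A m f u ->
  exists2 s, 0 < s & forall x, D x -> d x < s ->
    usc_env u x * d x `^ (q / m) <= l `^ (1 / m) + e.
Proof.
move=> l0 e0 fl usub; have e20 : 0 < e / 2 by rewrite divr_gt0.
have [t t01 tle] := param_above (1 / m) (- (q / m)) l0 e20.
have [s1 s10 fs1] := fl t (andP t01).1.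
have [C C0 ko] := viscosity_sub_ball m1 T0 trT.
have k0 : 0 < q / m - 2 / (m - 1).
  by rewrite subr_gt0 ltr_pdivlMr// mulrAC.
have [s2 s20 pows] := powR_small k0 e20 (powR_ge0 (C / t ^+ 2) (1 / (m - 1))).
exists (Num.min (s1 / 2) s2); first by rewrite lt_min divr_gt0.
move=> x Dx; rewrite lt_min => /andP[xs1 xs2].
have [dx0 BD Bd] := inner_ball Dx t01.
have /andP[t0 t1] := t01; have t10 : 0 < 1 - t by rewrite subr_gt0.
have lt0 : 0 < l + t by rewrite addr_gt0.
pose M := ((l + t) * ((1 - t) * d x) `^ (- q)) `^ (1 / m).
have Mm : M `^ m = (l + t) * ((1 - t) * d x) `^ (- q).
  by rewrite -powRrM div1r mulVf ?gt_eqF// powRr1// mulr_ge0 ?powR_ge0// ltW.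
have fM y : eball x (t * d x) y -> f y <= M `^ m.
  move=> xy; have /andP[dl du] := Bd _ xy; rewrite Mm.
  have dy0 : 0 < d y by rewrite (lt_le_trans _ dl)// mulr_gt0.
  have ys1 : d y < s1.
    rewrite (le_lt_trans du)// (@lt_trans _ _ (2 * d x))//.
      by rewrite ltr_pM2r// ltrD2l.
    by rewrite mulrC -ltr_pdivlMr.
  have := fs1 _ (BD _ xy) ys1; rewrite -ler_pdivlMr ?powR_gt0// => /le_trans; apply.
  rewrite ler_wpM2l ?(ltW lt0)// powRN lef_pV2 ?posrE ?powR_gt0// ?mulr_gt0//.
  by apply: le_powR_base => //; [exact: ltW|rewrite mulr_ge0 ?ltW].
have tdx0 : 0 < t * d x by rewrite mulr_gt0.
have := ko f u x (t * d x) M usub tdx0 (powR_ge0 _ _) BD fM.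
rewrite -(ler_pM2r (powR_gt0 (q / m) dx0)) => /le_trans; apply.
rewrite mulrDl [e in leRHS](splitr e) addrA; apply: lerD.
  apply: le_trans tle; rewrite /M powRM ?powR_ge0 ?(ltW lt0)// -powRrM.
  rewrite powRM ?(ltW t10) ?(ltW dx0)// mulrA -!mulrA div1r mulNr -powRD_gt0//.
  by rewrite addNr powRr0 mulr1 lexx.
have := pows (d x); rewrite dx0 xs2 => /(_ isT); apply: le_trans.
have -> : C / (t * d x) ^+ 2 = C / t ^+ 2 * (d x) `^ (- 2).
  by rewrite exprMn invfM mulrA powRN (powR_mulrn 2) ?ltW.
rewrite powRM ?powR_ge0 ?divr_ge0 ?sqr_ge0// -mulrA -powRrM -powRD_gt0//.
have -> // : - 2 * (1 / (m - 1)) + q / m = q / m - 2 / (m - 1).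
by rewrite addrC mulrA mulr1 mulNr.
Qed.

(** In the ball of radius [t d(x)] the source is at least
[(l - t) ((1 + t) d(x))^(-q)]. With [M = l^(1/m) d(x)^(-q/m)], either the
solution reaches [M], or it loses to the source a term of order
[d(x)^(-q/m-2)], negligible against [d(x)^(-q)] because [q > q/m + 2]. *)
Lemma super_rate l v b : 0 < l -> b < l `^ (1 / m) ->
  (forall e, 0 < e -> exists2 s, 0 < s &
     forall x, D x -> d x < s -> l - e <= f x * d x `^ q) ->
  (forall x, D x -> 0 <= v x) -> viscosity_super D A m f v ->
  exists2 s, 0 < s & forall x, D x -> d x < s ->
    b <= lsc_env v x * d x `^ (q / m).
Proof.
move=> l0 bL fl v0 vsuper.
have [b0|b0] := leP b 0.
  exists 1 => // x Dx _; rewrite (le_trans b0)// mulr_ge0 ?powR_ge0//.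
  exact: lsc_env_ge0 openD Dx v0.
set L := l `^ (1 / m) in bL; have L0 : 0 < L by rewrite powR_gt0.
have Lm : L `^ m = l by rewrite -powRrM div1r mulVf ?gt_eqF// powRr1// ltW.
have bml : b `^ m < l.
  by rewrite -Lm; apply: lt_powR_base => //; exact: ltW.
(* half of the gap between [b^m] and [l] is spent on the choice of [t],
   the other half on the lower order term *)
set c := (b `^ m + l) / 2.
have /andP[cb cl] : b `^ m < c < l by rewrite !midf_lt.
have c0 : 0 < c by rewrite (lt_trans _ cb)// powR_gt0.
have [t t01 ct] := param_below (- q) (introT andP (conj c0 cl)).
have [s1 s10 fs1] := fl t (andP t01).1.
have k0 : 0 < q - q / m - 2.
  have -> : q - q / m - 2 = (m - 1) / m * (q - 2 * m / (m - 1)).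
    by field; rewrite !gt_eqF.
  by rewrite mulr_gt0 ?divr_gt0// subr_gt0.
have cb0 : 0 < c - b `^ m by rewrite subr_gt0.
have K0 : 0 <= 2 * L * T / t ^+ 2 by rewrite divr_ge0 ?sqr_ge0// !mulr_ge0// ltW.
have [s2 s20 pows] := powR_small k0 cb0 K0.
exists (Num.min (s1 / 2) s2); first by rewrite lt_min divr_gt0.
move=> x Dx; rewrite lt_min => /andP[xs1 xs2].
have [dx0 BD Bd] := inner_ball Dx t01.
have /andP[t0 t1] := t01; have t10 : 0 < 1 + t by rewrite addr_gt0.
have lt0 : 0 < l - t.
  by rewrite -(pmulr_lgt0 _ (powR_gt0 (- q) t10)) (lt_le_trans c0).
have tdx0 : 0 < t * d x by rewrite mulr_gt0.
have dxm : d x `^ (- (q / m)) * d x `^ (q / m) = 1.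
  by rewrite powRN mulVf// gt_eqF// powR_gt0.
have dxq : d x `^ (- q) * d x `^ q = 1.
  by rewrite powRN mulVf// gt_eqF// powR_gt0.
have fc y : eball x (t * d x) y -> c * d x `^ (- q) <= f y.
  move=> xy; have /andP[dl du] := Bd _ xy.
  have dy0 : 0 < d y by rewrite (lt_le_trans _ dl)// mulr_gt0// subr_gt0.
  have ys1 : d y < s1.
    rewrite (le_lt_trans du)// (@lt_trans _ _ (2 * d x))//.
      by rewrite ltr_pM2r// ltrD2l.
    by rewrite mulrC -ltr_pdivlMr.
  have := fs1 _ (BD _ xy) ys1; rewrite -ler_pdivrMr ?powR_gt0//; apply: le_trans.
  apply: (@le_trans _ _ ((l - t) * ((1 + t) * d x) `^ (- q))).
    by rewrite powRM ?(ltW t10) ?(ltW dx0)// mulrA ler_wpM2r ?powR_ge0.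
  rewrite ler_wpM2l ?(ltW lt0)// powRN lef_pV2 ?posrE ?powR_gt0// ?mulr_gt0//.
  by apply: le_powR_base => //; [exact: ltW|rewrite ltW].
have [vL|vm] := viscosity_super_ball openD m0 trT vsuper v0 tdx0
    (mulr_ge0 (ltW L0) (powR_ge0 (d x) (- (q / m)))) BD fc.
  rewrite (le_trans (ltW bL))// -[leLHS]mulr1 -dxm mulrA.
  by rewrite ler_wpM2r ?powR_ge0.
have V0 := lsc_env_ge0 openD Dx v0.
have : b `^ m <= (lsc_env v x * d x `^ (q / m)) `^ m.
  rewrite powRM ?powR_ge0// -powRrM divfK ?gt_eqF//.
  move: vm; rewrite -(ler_pM2r (powR_gt0 q dx0)); apply: le_trans.
  rewrite mulrBl -(mulrA c) dxq mulr1 lerBrDl -lerBrDr.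
  have := pows (d x); rewrite dx0 xs2 => /(_ isT); apply: le_trans.
  rewrite le_eqVlt; apply/orP; left; apply/eqP.
  have -> : d x `^ (q - q / m - 2) =
      d x `^ (- (q / m)) * d x `^ q * (d x ^+ 2)^-1.
    rewrite -(powR_mulrn 2) ?(ltW dx0)// -powRN -!powRD_gt0//.
    by congr (_ `^ _); rewrite addrC; ring.
  rewrite exprMn invfM; move: (_ `^ _) (_ `^ q) => X Y.
  by ring.
rewrite leNgt => /negP bV; rewrite leNgt; apply/negP => Vb; apply: bV.
by apply: lt_powR_base => //; rewrite mulr_ge0 ?powR_ge0.
Qed.

End BoundaryRate.

(** * The boundary behaviour of sub- and supersolutions *)
Lemma to_bdP (R : realType) (N : nat) (D : set 'rV[R]_N) (P : 'rV[R]_N -> Prop) :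
  (exists2 V, to_bd D V & forall x, V x -> P x) <->
  (exists2 s : R, 0 < s & forall x, D x -> dist_bd D x < s -> P x).
Proof.
split=> [[V [s s0 sV] VP]|[s s0 sP]].
  by exists s => // x Dx ds; apply: VP; exact: sV.
by exists (collar D s) => [|x [Dx ds]]; [exists s|exact: sP].
Qed.

Unset Implicit Arguments.
Theorem theorem5p2 (R : realType) (N : nat) (hN : (1 < N)%N)
  (Omega : set 'rV[R]_N) (Omega_open : open Omega)
  (Omega_bounded : bounded_set Omega)
  (bd_C4 : Ck_boundary 4 Omega)
  (deltaO : R) (deltaO_gt0 : 0 < deltaO)
  (d_C4 : Ck 4 (collar Omega deltaO) (dist_bd Omega))
  (A : 'rV[R]_N -> 'M[R]_N)
  (A_psd : forall x, Omega x -> nonneg_symmetric (A x) /\ A x != 0)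
  (A_lip : [lipschitz A x | x in Omega])
  (E_smooth : exists delta1 : R, 0 < delta1 < deltaO /\
     in_Wkinfty 2 (collar Omega delta1) (normal_diffusion Omega A))
  (lambda Lambda : R) (lambda_gt0 : 0 < lambda) (le_lambda : lambda <= Lambda)
  (A_bounds : forall x xi : 'rV[R]_N, Omega x -> euclid xi = 1 ->
     0 <= \tr (A x *m otimes xi xi) <= Lambda)
  (A_normal : forall x, collar Omega deltaO x ->
     let n := - grad (dist_bd Omega) x in
     lambda <= \tr (A x *m otimes n n))
  (m q : R) (m_gt1 : 1 < m) (q_gt : 2 * m / (m - 1) < q)
  (f : 'rV[R]_N -> R) :
  let d := dist_bd Omega in
  let gamma := (q * (m - 1) - 2 * m) / m in
  (forall lu : R, 0 < lu ->
    (limf_esup (fun x => (f x * d x `^ q)%:E) (to_bd Omega) <= lu%:E)%E ->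
    forall u : 'rV[R]_N -> R, (forall x, Omega x -> 0 <= u x) ->
    viscosity_sub Omega A m f u ->
    (limf_esup (fun x => (usc_env u x /
        (d x `^ (- (q / m)) *
          (1 + corrector Omega A m q lu x * d x `^ gamma)))%:E)
      (to_bd Omega) <= (lu `^ (1 / m))%:E)%E)
  /\
  (forall ld : R, 0 < ld ->
    (limf_einf (fun x => (f x * d x `^ q)%:E) (to_bd Omega) >= ld%:E)%E ->
    forall v : 'rV[R]_N -> R, (forall x, Omega x -> 0 <= v x) ->
    viscosity_super Omega A m f v -> large Omega v ->
    (limf_einf (fun x => (lsc_env v x /
        (d x `^ (- (q / m)) *
          (1 + corrector Omega A m q ld x * d x `^ gamma)))%:E)
      (to_bd Omega) >= (ld `^ (1 / m))%:E)%E).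
Proof.
move=> d gamma.
have Lambda0 : 0 <= Lambda by rewrite (le_trans _ le_lambda)// ltW.
have N0 : (0 < N)%N by exact: ltnW.
have m0 : 0 < m by rewrite (lt_trans _ m_gt1).
have m10 : 0 < m - 1 by rewrite subr_gt0.
have q0 : 0 < q by apply: lt_trans q_gt; rewrite divr_gt0// mulr_gt0.
have gamma0 : 0 < gamma.
  by rewrite divr_gt0// subr_gt0 -ltr_pdivrMr.
have trT x : Omega x -> \tr (A x) <= N%:R * Lambda.
  by move=> Ox; apply: mxtrace_le => xi xi1; case/andP: (A_bounds x xi Ox xi1).
have T0 : 0 <= N%:R * Lambda by rewrite mulr_ge0.
have bd0 x : Omega x -> boundary Omega !=set0.
  exact: boundary_bounded_neq0.
pose K l := (q + m) * q / m ^+ 3 * l `^ (m / (m - 1)).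
have K0 l : 0 <= K l.
  by rewrite mulr_ge0 ?powR_ge0// divr_ge0 ?exprn_ge0 ?mulr_ge0 ?addr_ge0 ?ltW.
have corr l x : Omega x -> d x < deltaO ->
    0 <= corrector Omega A m q l x <= K l * (N%:R * Lambda).
  move=> Ox xd; have /andP[E0 E1] : 0 <= normal_diffusion Omega A x <= N%:R * Lambda.
    apply: normal_diffusion_bounds (bd0 _ Ox) _ Lambda0; last by move=> xi; exact: A_bounds.
    by apply: d_C4.1; split.
  by rewrite /corrector -/(K l) mulr_ge0//= ler_wpM2l.
have ratioE w x c : Omega x ->
    w / (d x `^ (- (q / m)) * (1 + c)) = w * d x `^ (q / m) / (1 + c).
  by move=> Ox; rewrite powRN invfM invrK mulrA.
split=> [l l0 /limf_esup_leP fl u u0 usub|l l0 /limf_einf_geP fl v v0 vsuper _].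
- (* the corrector is nonnegative, so the denominator is at least [d^(-q/m)] *)
  apply/limf_esup_leP => e e0; apply/to_bdP.
  have [[x0 Ox0]|O0] := pselect (Omega !=set0); last first.
    by exists 1 => // x Ox; case: O0; exists x.
  have fl' e' : 0 < e' -> exists2 s, 0 < s &
      forall x, Omega x -> d x < s -> f x * d x `^ q <= l + e'.
    by move=> /fl /to_bdP.
  have [s s0 us] := sub_rate Omega_open (bd0 _ Ox0) T0 trT m_gt1 q_gt l0 e0 fl' usub.
  exists (Num.min s deltaO); first by rewrite lt_min s0.
  move=> x Ox; rewrite lt_min => /andP[xs xd].
  have /andP[c0 _] := corr l x Ox xd.
  have c1 : 1 <= 1 + corrector Omega A m q l x * d x `^ gamma.
    by rewrite lerDl mulr_ge0 ?powR_ge0.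
  rewrite ratioE// ler_pdivrMr ?(lt_le_trans ltr01)//.
  rewrite (le_trans (us _ Ox xs))// ler_peMr// addr_ge0 ?powR_ge0//; exact: ltW.
- (* the corrector is bounded, so its product with [d^gamma] tends to [0] *)
  apply/limf_einf_geP => e e0; apply/to_bdP.
  have [[x0 Ox0]|O0] := pselect (Omega !=set0); last first.
    by exists 1 => // x Ox; case: O0; exists x.
  have fl' e' : 0 < e' -> exists2 s, 0 < s &
      forall x, Omega x -> d x < s -> l - e' <= f x * d x `^ q.
    by move=> /fl /to_bdP.
  set L := l `^ (1 / m); have L0 : 0 <= L by rewrite powR_ge0.
  have e20 : 0 < e / 2 by rewrite divr_gt0.
  have bL : L - e / 2 < L by rewrite gtrBl.
  have [s s0 vs] :=
    super_rate Omega_open (bd0 _ Ox0) T0 trT m_gt1 q_gt l0 bL fl' v0 vsuper.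
  have [s2 s20 pows] := powR_small gamma0 e20 (mulr_ge0 L0 (mulr_ge0 (K0 l) T0)).
  exists (Num.min s (Num.min s2 deltaO)); first by rewrite !lt_min s0 s20.
  move=> x Ox; rewrite !lt_min => /and3P[xs xs2 xd].
  have /andP[c0 cK] := corr l x Ox xd.
  have dx0 : 0 < d x by exact: dist_bd_gt0 (bd0 _ Ox) Ox.
  have := pows (d x); rewrite dx0 xs2 => /(_ isT).
  set c := corrector Omega A m q l x * d x `^ gamma => small.
  have cge0 : 0 <= c by rewrite mulr_ge0 ?powR_ge0.
  have Lc : L * c <= e / 2.
    by apply: le_trans small; rewrite -mulrA ler_wpM2l// ler_wpM2r ?powR_ge0.
  rewrite ratioE// ler_pdivlMr ?ltr_wpDr//.
  apply: le_trans (vs _ Ox xs).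
  rewrite mulrDr mulr1 mulrBl.
  have : 0 <= e * c by rewrite mulr_ge0// ltW.
  by move: (L * c) (e * c) Lc => a b; clear; lra.
Qed.
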